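(* For all $\varepsilon>0$, there exists a constant $C_\varepsilon>0$ such that for all integers $h\ge1$, $$V_{2,h}\ \ge\ \frac{7}{20}-\frac{C_\varepsilon}{\left(4^{1-\varepsilon}\right)^h}.$$
   Context: Two-player Levine hat game with $h\ge1$ hats: players A and B receive independent uniformly random stacks $U,V\in\{0,1\}^h$ ($1$ = black, $0$ = white). Each player sees only the other player's stack. An $h$-strategy is a function $k:\{0,1\}^h\to\{1,\dots,h\}$. If A uses $k_1$ and B uses $k_2$, the players win if and only if $U^{(k_1(V))}=V^{(k_2(U))}=1$, where $u^{(k)}$ is the $k$-th entry of $u$. $V_{2,h}$ denotes the maximum over all pairs $(k_1,k_2)$ of $h$-strategies of the winning probability. *)

(* Defs.v *)
From mathcomp Require Import all_boot all_order all_algebra.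
From mathcomp Require Import reals exp.
Set Implicit Arguments.
Unset Strict Implicit.
Unset Printing Implicit Defensive.
Import Order.TTheory GRing.Theory Num.Theory.
Local Open Scope ring_scope.

(* Hats are numbered from 0 to h - 1; true is black, false is white. *)
Definition stack (h : nat) : finType := {ffun 'I_h -> bool}.

Definition strategy (h : nat) : finType := {ffun stack h -> 'I_h}.

Definition wins (h : nat) (k1 k2 : strategy h) (u v : stack h) : bool :=
  u (k1 v) && v (k2 u).

Definition uniform (R : realFieldType) (h : nat) (u : stack h) : R :=
  #|stack h|%:R^-1.

(* The two stacks are independent: their joint law is the product law. *)
Definition win_prob (R : realFieldType) (h : nat) (k1 k2 : strategy h) : R :=
  \sum_(u : stack h) \sum_(v : stack h | wins k1 k2 u v)
     uniform R u * uniform R v.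

(* The base value 0 of the iterated maximum is harmless: winning probabilities
   are nonnegative, and strategies exist as soon as 0 < h. *)
Definition V2 (R : realFieldType) (h : nat) : R :=
  \big[Num.max/0]_(k : strategy h * strategy h) win_prob R k.1 k.2.

(* Main.v *)
Require Import Defs.
From mathcomp Require Import all_boot all_order all_algebra.
From mathcomp Require Import reals exp.
From mathcomp Require Import zify lra.
Set Implicit Arguments.
Unset Strict Implicit.
Unset Printing Implicit Defensive.
Import Order.TTheory GRing.Theory Num.Theory.
Local Open Scope ring_scope.

(** Good strategies for [n.+1] hats give good strategies for [n.+3] hats.  Each
    player arranges the first three hats of the stack he sees in a circle.  If
    they are not all of one colour, the circle has a single run of black hats:
    player A then names the position where the run that he sees starts, player
    B the position where the run that he sees ends.  If they are all of one
    colour, they count as a single hat, and the player uses his old strategy on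
    the resulting stack of [n.+1] hats.

    Besides the stack pairs won in the old game, which is played when both
    circles are of one colour, the new pair of strategies wins [21 * 4 ^ n] stack
    pairs ([win_count_extend]); here [4 ^ n] counts the hats outside the circles
    and [21 = 15 + 3 + 3] comes from the following cases.
    - Neither circle is of one colour.  Write [(a, b)] for the runs of A and B.
      The winning pairs are [({i}, {i})], [({i}, {i, i+1})],
      [({i, i+1}, {i+1})], [({i, i+1}, {i, i+1})] and
      [({i, i+1}, {i+1, i+2})] with [i] modulo 3: there are 15 of them.
    - One circle is of one colour, the other is one of the six that are not.
      The player with the one-coloured circle names a hat of it, so that colour
      must be black.  The other player's hat is chosen by the old strategy, by
      looking at a stack independent of it, and is black half of the time.  This
      makes [6 / 2] for each of the two players.

    Hence the winning probability [p] becomes [21 / 64 + p / 16].  The fixed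
    point of this map is [7 / 20], and the distance to it is divided by
    [16 = 4 ^ 2] whenever two hats are added.  So [V2] is at least
    [7 / 20 - (28 / 5) / 4 ^ h] ([V2_ge]), and [4 `^ (1 - eps)] is at most
    [4]. *)

(** * Counting winning stack pairs *)

Definition win_count (h : nat) (k1 k2 : strategy h) : nat :=
  (\sum_u \sum_v wins k1 k2 u v)%N.

Lemma card_stack h : #|stack h| = (2 ^ h)%N.
Proof. by rewrite card_ffun card_bool card_ord. Qed.

Lemma win_probE (R : realFieldType) h (k1 k2 : strategy h) :
  win_prob R k1 k2 = (win_count k1 k2)%:R / 4 ^+ h.
Proof.
rewrite /win_prob /win_count natr_sum mulr_suml; apply: eq_bigr => u _.
rewrite natr_sum mulr_suml big_mkcond /=; apply: eq_bigr => v _.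
rewrite /uniform card_stack natrX -invfM -exprMn -natrM.
by case: ifP => _; rewrite ?mul1r ?mul0r.
Qed.

Definition flip_hat h (i : 'I_h) (w : stack h) : stack h :=
  [ffun j => (j == i) (+) w j].

Lemma flip_hatK h (i : 'I_h) : involutive (flip_hat i).
Proof. by move=> w; apply/ffunP => j; rewrite !ffunE addbA addbb. Qed.

(** A hat named without looking at the stack is a fair coin: flipping it is an
    involution of the set of stacks. *)
Lemma sum_hat n (i : 'I_n.+1) (f : bool -> nat) :
  (\sum_(w : stack n.+1) f (w i) = 2 ^ n * (f true + f false))%N.
Proof.
have flipE : (\sum_(w : stack n.+1) f (w i) =
              \sum_(w : stack n.+1) f (~~ w i))%N.
  rewrite (reindex_inj (inv_inj (flip_hatK i))) /=.
  by apply: eq_bigr => w _; rewrite ffunE eqxx.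
suff dbl : (2 * \sum_(w : stack n.+1) f (w i) =
            2 ^ n.+1 * (f true + f false))%N.
  by rewrite expnS in dbl; lia.
rewrite mul2n -addnn {2}flipE -big_split /= -card_stack -sum_nat_const.
by apply: eq_bigr => w _; case: (w i); rewrite //= addnC.
Qed.

(** * Gluing the first three hats *)

Section Glue.
Variable n : nat.

Definition hat0 : 'I_n.+3 := @Ordinal n.+3 0 isT.
Definition hat1 : 'I_n.+3 := @Ordinal n.+3 1 isT.
Definition hat2 : 'I_n.+3 := @Ordinal n.+3 2 isT.

(** Where a hat of the glued stack sits in the original one; hat 0 stands for
    the whole triple. *)
Definition unglue (j : 'I_n.+1) : 'I_n.+3 :=
  if j == ord0 then hat0 else rshift 2 j.

Definition glue (u : stack n.+3) : stack n.+1 := [ffun j => u (unglue j)].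

(** Inverse to gluing, given the hats 1 and 2 that gluing forgets. *)
Definition unfold_stack (p : bool * bool * stack n.+1) : stack n.+3 :=
  [ffun i : 'I_n.+3 => match val i with
     | 0 => p.2 ord0 | 1 => p.1.1 | 2 => p.1.2 | k.+3 => p.2 (inord k.+1)
   end].

Definition fold_stack (u : stack n.+3) : bool * bool * stack n.+1 :=
  (u hat1, u hat2, glue u).

Lemma unfold_unglue p j : unfold_stack p (unglue j) = p.2 j.
Proof.
rewrite ffunE /unglue; case: eqP => [-> //|/eqP j0].
case: j j0 => [[|k] lt_k] //= _.
by congr (p.2 _); apply/val_inj; rewrite /= inordK.
Qed.

Lemma unfold_stackK : cancel unfold_stack fold_stack.
Proof.
move=> [[a b] w]; rewrite /fold_stack !ffunE /=; congr (_, _, _).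
by apply/ffunP => j; rewrite ffunE unfold_unglue.
Qed.

Lemma fold_stackK : cancel fold_stack unfold_stack.
Proof.
move=> u; apply/ffunP => -[i lt_i]; rewrite ffunE /=.
case: i lt_i => [|[|[|k]]] lt_i /=; rewrite ?ffunE.
- by congr (u _); apply/val_inj.
- by congr (u _); apply/val_inj.
- by congr (u _); apply/val_inj.
congr (u _); apply/val_inj; rewrite /unglue -val_eqE /= inordK //=.
by rewrite inordK.
Qed.

Lemma sum_unfold (F : stack n.+3 -> nat) :
  (\sum_u F u = \sum_w \sum_a \sum_b F (unfold_stack (a, b, w)))%N.
Proof.
rewrite (reindex unfold_stack); last first.
  by exists fold_stack => ? _; [apply: unfold_stackK | apply: fold_stackK].
rewrite exchange_big /=.
under [RHS]eq_bigr do rewrite exchange_big.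
by rewrite /= pair_bigA pair_bigA; apply: eq_bigr => -[[a b] w].
Qed.

(** * Runs of black hats on a circle of three *)

Definition one_colour (a b c : bool) := (a == b) && (b == c).

Definition at3 T (a b c : T) (k : nat) : T :=
  match k with 0 => a | 1 => b | _ => c end.

(** A run starts after a white hat and ends before one.  If hats 0 and 1 are
    excluded, only hat 2 remains on a circle that is not of one colour. *)
Definition run_start (a b c : bool) : nat :=
  if a && ~~ c then 0 else if b && ~~ a then 1 else 2.

Definition run_end (a b c : bool) : nat :=
  if a && ~~ b then 0 else if b && ~~ c then 1 else 2.

Definition extend (pick : bool -> bool -> bool -> nat) (k : strategy n.+1) :
    strategy n.+3 :=
  [ffun v : stack n.+3 =>
     if one_colour (v hat0) (v hat1) (v hat2) then unglue (k (glue v))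
     else at3 hat0 hat1 hat2 (pick (v hat0) (v hat1) (v hat2))].

Lemma extend_hatE pick k a b a' b' (w w' : stack n.+1) :
  unfold_stack (a, b, w) (extend pick k (unfold_stack (a', b', w'))) =
  if one_colour (w' ord0) a' b' then w (k w')
  else at3 (w ord0) a b (pick (w' ord0) a' b').
Proof.
rewrite [extend _ _ _]ffunE.
have -> : glue (unfold_stack (a', b', w')) = w'.
  by apply/ffunP => j; rewrite ffunE unfold_unglue.
rewrite ![unfold_stack (a', b', w') _]ffunE /=.
case: ifP => _; first by rewrite unfold_unglue.
by case: (pick _ _ _) => [|[|?]]; rewrite /= ffunE.
Qed.

(** The 15 wins between two circles that are not of one colour, sorted by the
    colours [x] and [y] of their hats 0.  These two hats stay in the glued
    stacks, so their colours are fixed when the other hats of the circles are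
    summed over. *)
Definition run_wins (x y : bool) : nat :=
  match x, y with
  | true, true => 6 | false, false => 5 | _, _ => 2
  end.

(** The sixteen ways to unfold a pair of glued stacks: one plays the old game,
    two times three mix the old game with a run, nine play with two runs. *)
Lemma sum_wins_extend k1 k2 (w w' : stack n.+1) :
  (\sum_a \sum_b \sum_a' \sum_b'
     wins (extend run_start k1) (extend run_end k2)
       (unfold_stack (a, b, w)) (unfold_stack (a', b', w')) =
   wins k1 k2 w w' + 3 * (w' ord0 && w (k1 w')) + 3 * (w ord0 && w' (k2 w))
   + run_wins (w ord0) (w' ord0))%N.
Proof.
rewrite !big_bool /wins !extend_hatE.
by case: (w ord0); case: (w' ord0); case: (w (k1 w')); case: (w' (k2 w)).
Qed.

(** Apart from the wins of the old game, each term of [sum_wins_extend] depends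
    on one hat of [w] for given [w'] or on one hat of [w'] for given [w], and
    then on hat 0 of the other stack, so [sum_hat] applies twice: a mixed term
    is true for a quarter of the [4 ^ n.+1] pairs, whence [3 * 4 ^ n] for each
    player. *)
Lemma win_count_extend k1 k2 :
  win_count (extend run_start k1) (extend run_end k2) =
  (21 * 4 ^ n + win_count k1 k2)%N.
Proof.
have half (k : strategy n.+1) :
    (\sum_(w' : stack n.+1) \sum_(w : stack n.+1) 3 * (w' ord0 && w (k w'))
     = 3 * 4 ^ n)%N.
  under eq_bigr => w' _ do rewrite (sum_hat _ (fun c => 3 * (w' ord0 && c))%N).
  rewrite (sum_hat _ (fun c => 2 ^ n * (3 * (c && true) + 3 * (c && false)))%N).
  by rewrite -[4%N]/(2 * 2)%N expnMn /=; lia.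
have runs : (\sum_(w : stack n.+1) \sum_(w' : stack n.+1)
               run_wins (w ord0) (w' ord0) = 15 * 4 ^ n)%N.
  under eq_bigr => w _ do rewrite (sum_hat _ (run_wins (w ord0))).
  rewrite (sum_hat _ (fun x => 2 ^ n * (run_wins x true + run_wins x false))%N).
  by rewrite -[4%N]/(2 * 2)%N expnMn /=; lia.
have -> : win_count (extend run_start k1) (extend run_end k2) =
  (\sum_(w : stack n.+1) \sum_(w' : stack n.+1)
     (wins k1 k2 w w' + 3 * (w' ord0 && w (k1 w')) + 3 * (w ord0 && w' (k2 w))
      + run_wins (w ord0) (w' ord0)))%N.
  rewrite /win_count sum_unfold; apply: eq_bigr => w _.
  under eq_bigr => a _ do under eq_bigr => b _ do rewrite sum_unfold.
  under eq_bigr => a _ do rewrite exchange_big.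
  rewrite exchange_big /=; apply: eq_bigr => w' _.
  exact: sum_wins_extend.
have halfA := half k1; rewrite exchange_big in halfA.
(* Not more than three splits, since [3 * _] unfolds to a sum as well. *)
under eq_bigr do rewrite 3!big_split /=.
rewrite 3!big_split /= runs (half k2) halfA.
by rewrite -/(win_count k1 k2); lia.
Qed.

End Glue.

(** * Convergence to 7/20 *)

(** Since [20 * 21 = 7 * (4 ^ 3 - 4)], adding two hats leaves the deficit
    [7 * 4 ^ h - 20 * win_count] unchanged.  The bound [112 = 7 * 4 ^ 2] on it is
    trivial for one or two hats. *)
Lemma exists_win_count n :
  exists k1 k2 : strategy n.+1, (7 * 4 ^ n.+1 <= 20 * win_count k1 k2 + 112)%N.
Proof.
have [m] := ubnP n; elim: m n => // m IHm [|[|n]] lt_n_m.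
- by exists [ffun=> ord0], [ffun=> ord0]; rewrite (leq_trans _ (leq_addl _ _)).
- by exists [ffun=> ord0], [ffun=> ord0]; rewrite (leq_trans _ (leq_addl _ _)).
have [|k1 [k2 le_k]] := IHm n; first by lia.
exists (extend run_start k1), (extend run_end k2).
by move: le_k; rewrite win_count_extend !expnS; lia.
Qed.

Lemma V2_ge (R : realFieldType) n :
  7 / 20 - 28 / 5 / 4 ^+ n.+1 <= V2 R n.+1.
Proof.
have [k1 [k2 le_k]] := exists_win_count n.
apply: le_trans (le_bigmax _ (fun k => win_prob R k.1 k.2) (k1, k2)) => /=.
have pow_gt0 : 0 < 4 ^+ n.+1 :> R by rewrite exprn_gt0.
rewrite win_probE ler_pdivlMr // mulrBl divfK ?gt_eqF //.
have: (7 * 4 ^ n.+1)%:R <= (20 * win_count k1 k2 + 112)%:R :> R.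
  by rewrite ler_nat.
by rewrite natrD !natrM natrX; lra.
Qed.

Theorem theorem27 (R : realType) (eps : R) (eps_gt0 : 0 < eps) :
  exists C : R, 0 < C /\
    forall h : nat, (1 <= h)%N ->
      7 / 20 - C / (4 `^ (1 - eps)) ^+ h <= V2 R h.
Proof.
exists (28 / 5); split=> [|[//|n] _]; first by lra.
apply: le_trans (V2_ge R n); rewrite lerD2l lerN2 ler_pM2l; last by lra.
have pow_gt0 : 0 < 4 `^ (1 - eps) by rewrite powR_gt0.
have le_4 : 4 `^ (1 - eps) <= 4 :> R.
  rewrite -[leRHS]powRr1 //; apply: ler_powR; first by lra.
  by rewrite gerBl ltW.
rewrite lef_pV2 ?posrE ?exprn_gt0 //.
by rewrite lerXn2r // ?nnegrE // ltW.
Qed.
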